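(* Let $\mathcal{S}=(X,T,X_0,\to,\Sigma,\ell)$ be a deterministic finite automaton such that each of its events can be directly observed. Then $\mathcal{S}$ is strongly detectable if and only if $\mathcal{S}$ is eventually strongly detectable.
   Context: A finite automaton is a sextuple $\mathcal{S}=(X,T,X_0,\to,\Sigma,\ell)$ with $X$ a finite set of states, $T$ a finite set of events, $X_0\subset X$ a set of initial states, $\to\subset X\times T\times X$ a transition relation, $\Sigma$ a finite set of labels, and $\ell:T\to\Sigma\cup\{\epsilon\}$ a labeling function ($\epsilon$ the empty word), extended to finite and infinite event sequences by concatenation. Write $x\xrightarrow{s}x'$ for $s\in T^+$ if there is a sequence of transitions from $x$ to $x'$ with event sequence $s$. $\mathcal{S}$ is deterministic if $(x,t,x'),(x,t,x'')\in\to$ implies $x'=x''$ (several initial states are allowed). An event $t$ can be directly observed if $\ell(t)\in\Sigma$ (so $\ell(t)\neq\epsilon$) and $\ell(t)\neq\ell(t')$ for every other event $t'\in T$. For $\sigma\in\Sigma^*$, $\mathcal{M}(\mathcal{S},\sigma)=\{x\in X\mid \exists x_0\in X_0,\exists s\in T^+: \ell(s)=\sigma,\ x_0\xrightarrow{s}x\}$, with $X_0$ additionally included when $\sigma=\epsilon$. $\mathcal{L}^\omega(\mathcal{S})$ is the set of $\sigma\in\Sigma^\omega$ such that $\sigma=\ell(t_1t_2\dots)$ for some $t_1t_2\dots\in T^\omega$ for which there are states $x_0,x_1,\dots$ with $x_0\in X_0$ and $(x_i,t_{i+1},x_{i+1})\in\to$ for all $i\in\mathbb{N}$. $\mathcal{S}$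 is strongly detectable if there is a positive integer $k$ such that for every $\sigma\in\mathcal{L}^\omega(\mathcal{S})$, $|\mathcal{M}(\mathcal{S},\sigma')|=1$ for every finite prefix $\sigma'$ of $\sigma$ with $|\sigma'|>k$. $\mathcal{S}$ is eventually strongly detectable if for every $\sigma\in\mathcal{L}^\omega(\mathcal{S})$ there is a positive integer $k_\sigma$ such that $|\mathcal{M}(\mathcal{S},\sigma')|=1$ for every finite prefix $\sigma'$ of $\sigma$ with $|\sigma'|>k_\sigma$. *)

(* Defs.v *)
From mathcomp Require Import all_boot.
From mathcomp Require Import boolp.

Set Implicit Arguments.
Unset Strict Implicit.
Unset Printing Implicit Defensive.

(* [lab t = None] encodes the empty word as the label of [t]. *)
Record automaton := Automaton {
  state : finType;
  event : finType;
  init : {set state};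
  trans : {set state * event * state};
  letter : finType;
  lab : event -> option letter
}.

Section Automata.

Variable S : automaton.

Implicit Types (x y : state S) (s : seq (event S)) (w : seq (letter S)).

Definition deterministic : Prop :=
  forall x (t : event S) y y',
    (x, t, y) \in trans S -> (x, t, y') \in trans S -> y = y'.

Definition directly_observed (t : event S) : Prop :=
  lab t <> None /\ forall t' : event S, t' <> t -> lab t <> lab t'.

(* [pmap] drops the events labelled by the empty word. *)
Definition label_seq s : seq (letter S) := pmap (@lab S) s.

(* The infinite concatenation of the labels of [t] is the infinite word
   [sigma]: the labels of the finite prefixes of [t] are prefixes of [sigma]
   of unbounded length, so [t] has infinitely many non-silent events. *)
Definition label_omega (t : nat -> event S) (sigma : nat -> letter S) : Prop :=
  (forall n, let w := label_seq (mkseq t n) in w = mkseq sigma (size w)) /\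
  (forall m, exists n, m <= size (label_seq (mkseq t n))).

Fixpoint run x s y : Prop :=
  if s is t :: s' then exists2 z, (x, t, z) \in trans S & run z s' y
  else x = y.

Definition current_states w : {set state S} :=
  [set x | `[< exists x0 s, [/\ x0 \in init S, s <> [::],
                               label_seq s = w & run x0 s x] >]]
  :|: (if w is [::] then init S else set0).

Definition omega_language (sigma : nat -> letter S) : Prop :=
  exists t : nat -> event S, label_omega t sigma /\
    exists x : nat -> state S,
      x 0 \in init S /\ forall i, (x i, t i, x i.+1) \in trans S.

(* The prefix of length [n] of [sigma] is [mkseq sigma n]. *)
Definition strongly_detectable : Prop :=
  exists k : nat, 0 < k /\
    forall sigma, omega_language sigma ->
      forall n, k < n -> #|current_states (mkseq sigma n)| = 1.

Definition eventually_strongly_detectable : Prop :=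
  forall sigma, omega_language sigma ->
    exists k : nat, 0 < k /\
      forall n, k < n -> #|current_states (mkseq sigma n)| = 1.

End Automata.

(* Main.v *)
Require Import Defs.
From mathcomp Require Import all_boot.
From mathcomp Require Import boolp.

Set Implicit Arguments.
Unset Strict Implicit.
Unset Printing Implicit Defensive.

(** Reading one letter maps the current-state estimate to its image under a
    partial function, so the cardinality of the estimate never increases. If an
    estimate with at least two states survives long enough, then by pigeonhole
    some estimate occurs twice, at positions [i < j]. Between [i] and [j] the
    cardinality is constant, hence no state of the estimate is lost there: every
    state can read the next letter. Therefore the word that repeats the
    segment from [i] to [j] forever is in the omega-language, and all its
    estimates have at least two states. *)

Section Estimates.

Variable S : automaton.

Implicit Types (x y z : state S) (t : event S) (a : letter S).
Implicit Types (E : {set state S}) (w : seq (letter S)).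
Implicit Types (sigma : nat -> letter S).

Definition succ a x y : bool :=
  [exists t, (lab t == Some a) && ((x, t, y) \in trans S)].

Definition step E a : {set state S} := [set y | [exists x in E, succ a x y]].

Definition estimate sigma n : {set state S} :=
  foldl step (init S) (mkseq sigma n).

Lemma succP a x y :
  reflect (exists2 t, lab t = Some a & (x, t, y) \in trans S) (succ a x y).
Proof.
apply: (iffP existsP) => [[t /andP[/eqP lt tr]]|[t lt tr]]; exists t => //.
by rewrite lt eqxx.
Qed.

Lemma stepP E a y : reflect (exists2 x, x \in E & succ a x y) (y \in step E a).
Proof.
rewrite inE; apply: (iffP existsP) => [[x /andP[]]|[x xE sxy]]; exists x => //.
by rewrite xE.
Qed.

Lemma estimateS sigma n :
  estimate sigma n.+1 = step (estimate sigma n) (sigma n).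
Proof. by rewrite /estimate mkseqS foldl_rcons. Qed.

Lemma mem_estimate sigma (x : nat -> state S) n :
  x 0 \in init S -> (forall i, succ (sigma i) (x i) (x i.+1)) ->
  x n \in estimate sigma n.
Proof.
move=> x0 xS; elim: n => [|n IHn] //.
by rewrite estimateS; apply/stepP; exists (x n).
Qed.

Section NoSilentEvent.

Hypothesis observed : forall t, lab t <> None.

Lemma size_label_seq (s : seq (event S)) : size (label_seq s) = size s.
Proof.
elim: s => //= t s IHs; case lt: (lab t) => [a|] /=; last by case: (observed lt).
by rewrite IHs.
Qed.

(** [E] is arbitrary because the induction on [w] replaces it by [step E a]. With no silent event,
    each letter of [w] consumes exactly one event of [s]. *)
Lemma foldl_stepP w E y :
  y \in foldl step E w <->
  exists x s, [/\ x \in E, label_seq s = w & run x s y].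
Proof.
elim: w E => [|a w IHw] E /=.
  split=> [yE|[x [[|t s] [xE sw r]]]]; first by exists y, [::].
    by rewrite -r.
  by have := size_label_seq (t :: s); rewrite sw.
rewrite IHw; split=> [[x [s [/stepP[z zE /succP[t lt tr]] sw r]]]|].
  exists z, (t :: s); split=> //; last by exists x.
  by rewrite /label_seq /= lt /= -sw.
case=> x [[|t s] [xE sw r]] //; case: r => z tr r.
move: sw; rewrite /label_seq /=; case lt: (lab t) => [b|] /=; last first.
  by case: (observed lt).
case=> eb sw; exists z, s; split=> //.
by apply/stepP; exists x => //; apply/succP; exists t; rewrite // lt eb.
Qed.

Lemma current_statesE w : current_states w = foldl step (init S) w.
Proof.
apply/setP=> y; apply/idP/idP.
  rewrite !inE => /orP[/asboolP[x [s [xI _ sw r]]]|].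
    by apply/foldl_stepP; exists x, s.
  by case: w => [|a w] //; rewrite inE.
case: w => [|a w] yE; first by rewrite inE yE orbT.
have /foldl_stepP[x [s [xI sw r]]] := yE.
rewrite !inE; apply/orP; left; apply/asboolP; exists x, s; split=> //.
by move=> s0; rewrite s0 in sw.
Qed.

(** Every event emits exactly one letter, so the first [n] events spell the first [n] letters;
    comparing [n] with [n.+1] isolates the label of [t n]. *)
Lemma label_omegaP (t : nat -> event S) sigma :
  label_omega t sigma <-> forall n, lab (t n) = Some (sigma n).
Proof.
split=> [[pref _] n|lt].
  have prefE m : label_seq (mkseq t m) = mkseq sigma m.
    by have := pref m; cbv zeta; rewrite size_label_seq size_mkseq.
  have := prefE n.+1.
  rewrite !mkseqS /label_seq -cats1 pmap_cat -/(label_seq _) prefE /=.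
  case: (lab (t n)) (@observed (t n)) => [a _|] //=.
  by rewrite cats1 => /rcons_inj[->].
have labE n : label_seq (mkseq t n) = mkseq sigma n.
  by elim: n => // n IHn; rewrite !mkseqS -IHn /label_seq -!cats1 pmap_cat /= lt.
split=> [n|n]; first by rewrite /= labE size_mkseq.
by exists n; rewrite labE size_mkseq.
Qed.

Lemma omega_languageP sigma :
  omega_language sigma <->
  exists2 x : nat -> state S,
    x 0 \in init S & forall i, succ (sigma i) (x i) (x i.+1).
Proof.
split=> [[t [/label_omegaP lt [x [x0 xS]]]]|[x x0 xS]].
  by exists x => // i; apply/succP; exists (t i).
have /choice[t tP] i : exists t, lab t = Some (sigma i) /\
    (x i, t, x i.+1) \in trans S.
  by have /succP[t] := xS i; exists t.
exists t; split; first by apply/label_omegaP => n; case: (tP n).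
by exists x; split=> // i; case: (tP i).
Qed.

End NoSilentEvent.

Section DeterministicSucc.

Hypothesis succ_inj : forall a x y z, succ a x y -> succ a x z -> y = z.

(** The default [x] is a filler that makes [next] total; the value is meaningful only where [a] is
    enabled. *)
Definition next a x : state S := odflt x [pick y | succ a x y].

Lemma nextE a x y : succ a x y -> next a x = y.
Proof.
rewrite /next; case: pickP => [z sz sy|none]; last by rewrite none.
exact: succ_inj sz sy.
Qed.

Definition enabled a x : bool := [exists y, succ a x y].

Lemma succ_next a x : enabled a x -> succ a x (next a x).
Proof. by case/existsP=> y sy; rewrite (nextE sy). Qed.

Lemma stepE E a : step E a = next a @: [set x in E | enabled a x].
Proof.
apply/setP=> y; apply/stepP/imsetP=> [[x xE sy]|[x]].
  exists x; last by rewrite (nextE sy).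
  by rewrite inE xE; apply/existsP; exists y.
by rewrite inE => /andP[xE en] ->; exists x => //; apply: succ_next.
Qed.

Lemma card_step E a : #|step E a| <= #|E|.
Proof.
rewrite stepE (leq_trans (leq_imset_card _ _)) //.
by apply/subset_leq_card/subsetP=> x; rewrite inE => /andP[].
Qed.

(** The step is the image of the enabled part of [E], so it can be as large as [E] only if that part
    is all of [E]. *)
Lemma enabled_card_step E a x :
  #|E| <= #|step E a| -> x \in E -> enabled a x.
Proof.
rewrite stepE => le xE.
have sub : [set x in E | enabled a x] \subset E.
  by apply/subsetP=> z; rewrite inE => /andP[].
have /eqP eqE : [set x in E | enabled a x] == E.
  by rewrite eqEcard sub (leq_trans le) // leq_imset_card.
by move: xE; rewrite -{1}eqE inE => /andP[].
Qed.

Lemma card_estimate sigma m n :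
  m <= n -> #|estimate sigma n| <= #|estimate sigma m|.
Proof.
move=> /subnK <-; elim: (n - m) => // d IHd.
by rewrite addSn estimateS (leq_trans (card_step _ _)).
Qed.

Lemma estimate_collision sigma :
  exists i j, [/\ i < j, j <= #|{set state S}| &
                  estimate sigma i = estimate sigma j].
Proof.
pose f (i : 'I_#|{set state S}|.+1) := estimate sigma i.
have /injectivePn[i [j ij fij]] : ~~ injectiveb f.
  by apply/negP=> /injectiveP/leq_card; rewrite card_ord ltnn.
move: ij fij; rewrite -val_eqE neq_ltn => /orP[] lt fij.
  by exists i, j; split=> //; rewrite -ltnS.
by exists j, i; split=> //; rewrite -ltnS.
Qed.

(* Positions [0], ..., [j - 1], then back to [i]: position [j] is never reached. *)
Definition lasso i j n : nat :=
  iter n (fun q => if q.+1 == j then i else q.+1) 0.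

Lemma lasso_lt i j n : i < j -> lasso i j n < j.
Proof.
move=> ij; elim: n => [|n IHn] /=; first exact: leq_ltn_trans ij.
by case: eqP => // /eqP neq; rewrite ltn_neqAle neq.
Qed.

Section Pumping.

Variables (sigma : nat -> letter S) (i j : nat).
Hypothesis lt_ij : i < j.
Hypothesis eq_ij : estimate sigma i = estimate sigma j.

Let pumped n := sigma (lasso i j n).

(** At the jump, position [j] is replaced by [i], where the estimate is the same by [eq_ij]. *)
Lemma estimate_lassoS n :
  estimate sigma (lasso i j n.+1) =
  step (estimate sigma (lasso i j n)) (pumped n).
Proof. by rewrite -estimateS /=; case: eqP => // ->. Qed.

Lemma estimate_pumped n : estimate pumped n = estimate sigma (lasso i j n).
Proof. by elim: n => // n IHn; rewrite estimate_lassoS -IHn estimateS. Qed.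

(** Before position [i] the estimates may shrink, so the new run has to copy [x] there; inside the
    loop any state of the estimate can continue. *)
Lemma pumped_run (x : nat -> state S) :
  x 0 \in init S -> (forall n, succ (sigma n) (x n) (x n.+1)) ->
  exists2 y : nat -> state S,
    y 0 \in init S & forall n, succ (pumped n) (y n) (y n.+1).
Proof.
move=> x0 xS.
pose y := fix y n := if n is m.+1 then next (pumped m) (y m) else x 0.
exists y => // n; apply: succ_next.
have live m : y m \in estimate sigma (lasso i j m) ->
    (lasso i j m < i -> y m = x (lasso i j m)) -> enabled (pumped m) (y m).
  move=> yE yx; have [lt_i|ge_i] := ltnP (lasso i j m) i.
    by rewrite yx //; apply/existsP; exists (x (lasso i j m).+1); apply: xS.
  apply: enabled_card_step yE; rewrite -estimateS.
  (* With [p] the lasso position, [i <= p < j]: the size at [p] is at most that at [i], equal to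
     that at [j], which is at most that at [p.+1]. *)
  rewrite (leq_trans (card_estimate sigma ge_i)) // eq_ij card_estimate //.
  exact: lasso_lt.
suff [] : y n \in estimate sigma (lasso i j n) /\
    (lasso i j n < i -> y n = x (lasso i j n)) by apply: live.
elim: n => [|n [yE yx]]; first by [].
split.
  rewrite estimate_lassoS; apply/stepP; exists (y n) => //.
  exact/succ_next/live.
(* A jump lands on [i] itself, outside the stem, so agreement with [x] is only claimed for ordinary
   steps. *)
rewrite /=; case: eqP => _ lt_i; first by rewrite ltnn in lt_i.
by rewrite yx ?(ltnW lt_i) //; exact/nextE/xS.
Qed.

End Pumping.

End DeterministicSucc.

End Estimates.

Theorem proposition8 (S : automaton)
    (hdet : deterministic S)
    (hobs : forall t : event S, directly_observed t) :
  strongly_detectable S <-> eventually_strongly_detectable S.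
Proof.
split=> [[k [k0 kP]] sigma sL|ev]; first by exists k; split=> //; apply: kP.
have observed (t : event S) : lab t <> None by case: (hobs t).
have succ_inj (a : letter S) x y z : succ a x y -> succ a x z -> y = z.
  case/succP=> t lt tr /succP[t' lt' tr']; apply: hdet tr _.
  (* Distinct events never share a label, so determinism of [trans] passes to letters. *)
  suff -> : t = t' by [].
  apply: contrapT => ne; case: (hobs t') => _ /(_ t ne); apply.
  by rewrite lt lt'.
(* Beyond this bound, [n] exceeds the position [j] of the collision, hence every lasso position. *)
exists #|{set state S}|.+1; split=> // sigma sL n lt_n.
have [x x0 xS] := (omega_languageP observed sigma).1 sL.
rewrite current_statesE // -/(estimate sigma n).
apply/eqP; rewrite eqn_leq andbC card_gt0; apply/andP; split.
  by apply/set0Pn; exists (x n); apply: mem_estimate.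
rewrite leqNgt; apply/negP => gt1.
have [i [j [lt_ij le_j eq_ij]]] := estimate_collision sigma.
have [y y0 yS] := pumped_run succ_inj lt_ij eq_ij x0 xS.
have [|k [_ kP]] := ev (fun m => sigma (lasso i j m)).
  by apply/omega_languageP => //; exists y.
have := kP k.+1 (ltnSn k).
rewrite current_statesE // -/(estimate _ _) (estimate_pumped eq_ij) => card1.
suff : 1 < #|estimate sigma (lasso i j k.+1)| by rewrite card1.
(* The lasso position lies before [n], so its estimate is at least as large as the one at [n]. *)
apply: leq_trans gt1 (card_estimate succ_inj _ _).
rewrite (leq_trans (ltnW (lasso_lt _ lt_ij))) // (leq_trans le_j) //.
exact/ltnW/ltnW.
Qed.
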